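(* Fix $H$ and $\Lambda$. Suppose that for every $k \in V(H)$ there is $a_\Lambda(k)$ such that $a_\Lambda^-(k)=a_\Lambda^+(k)=a_\Lambda(k)$. Then there are positive constants $c_1,c_2,c_3,c_4$ (depending only on $H$ and $\Lambda$) such that for every $d\ge 1$, every $N$ and every $d$-regular bipartite graph $G$ on $N$ vertices the following two statements hold, where $f$ denotes a random element of ${\rm Hom}(G,H)$ chosen according to $p_\Lambda$. (1) For every $\varepsilon \geq c_1/\sqrt{d}$, $$p_\Lambda\left(\left\|(s(k,f))_{k \in V(H)}-(a_\Lambda(k))_{k \in V(H)}\right\|_\infty \geq \varepsilon \right) \leq c_2\varepsilon^{-1}2^{-c_3\varepsilon^2N}.$$ (2) $$\left\|(\bar{p}_\Lambda(k))_{k \in V(H)}-(a_\Lambda(k))_{k \in V(H)}\right\|_\infty \leq c_4\zeta,\qquad \text{where } \zeta = \max\left\{\frac{1}{\sqrt{d}},\sqrt{\frac{\log N}{N}}\right\}.$$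
   Context: $G=(V(G),E(G))$ is a simple, loopless, finite graph; $H$ is a finite graph without multiple edges but perhaps with loops, having at least one edge (possibly a loop); $\Lambda=\{\lambda_i : i\in V(H)\}$ is a set of positive real weights indexed by the vertices of $H$. Logarithms are to base 2. An $H$-colouring of $G$ is a function $f:V(G)\to V(H)$ such that $uv\in E(G)$ implies $f(u)f(v)\in E(H)$; ${\rm Hom}(G,H)$ is the set of these. Put $w_\Lambda(f)=\prod_{v\in V(G)}\lambda_{f(v)}$, $Z_\Lambda(G,H)=\sum_{f\in{\rm Hom}(G,H)}w_\Lambda(f)$, and let $p_\Lambda$ be the probability distribution on ${\rm Hom}(G,H)$ with $p_\Lambda(f)=w_\Lambda(f)/Z_\Lambda(G,H)$. For $f \in {\rm Hom}(G,H)$ and $k\in V(H)$ let $s(k,f)=|f^{-1}(k)|/|V(G)|$ and let $\bar p_\Lambda(k)=\frac{1}{|V(G)|}\sum_{v\in V(G)}p_\Lambda(f(v)=k)$, the expectation of $s(k,f)$ under $p_\Lambda$. For $A,B\subseteq V(H)$ write $A\sim B$ if $uv\in E(H)$ for all $u\in A$, $v\in B$. Let $w_\Lambda(A)=\sum_{i\in A}\lambda_i$, $\eta_\Lambda(H)=\max\{w_\Lambda(A)w_\Lambda(B):A\sim B\}$, and $\mathcal{M}_\Lambda(H)=\{(A,B): A,B\subseteq V(H),\ A\sim B,\ w_\Lambda(A)w_\Lambda(B)=\eta_\Lambda(H)\}$. For $k\in V(H)$ let $$a_\Lambda^+(k)=\frac{\max\{w_\Lambda(A)\lambda_k\mathbf{1}_{\{k\in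 B\}}+w_\Lambda(B)\lambda_k\mathbf{1}_{\{k\in A\}}:(A,B)\in\mathcal{M}_\Lambda(H)\}}{2\eta_\Lambda(H)},$$ and let $a_\Lambda^-(k)$ be defined in the same way with $\max$ replaced by $\min$. *)

(* Defs.v *)
From HB Require Import structures.
From mathcomp Require Import all_boot all_order all_algebra.
From mathcomp Require Import reals exp.

Set Implicit Arguments.
Unset Strict Implicit.
Unset Printing Implicit Defensive.

Import Order.TTheory GRing.Theory Num.Theory.
Local Open Scope ring_scope.

Section Graphs.
Variables (V : finType) (e : rel V).

Definition simple_graph : Prop := symmetric e /\ irreflexive e.

Definition regular (d : nat) : Prop := forall v : V, #|[set u | e v u]| = d.

Definition bipartite : Prop :=
  exists X : {set V}, forall u v : V, e u v -> (u \in X) != (v \in X).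

End Graphs.

Section Target.
Variables (R : realType) (W : finType) (eH : rel W) (lam : W -> R).

Definition complete_to (A B : {set W}) : bool :=
  [forall u in A, forall v in B, eH u v].

Definition setw (A : {set W}) : R := \sum_(i in A) lam i.

(* For positive weights all products are nonnegative and (set0, set0) is
   admissible, so the default value 0 does not affect the maximum. *)
Definition eta : R :=
  \big[Num.max/0]_(AB : {set W} * {set W} | complete_to AB.1 AB.2)
     (setw AB.1 * setw AB.2).

Definition Mset : {set {set W} * {set W}} :=
  [set AB | complete_to AB.1 AB.2 && (setw AB.1 * setw AB.2 == eta)].

Definition a_term (k : W) (AB : {set W} * {set W}) : R :=
  setw AB.1 * lam k * (k \in AB.2)%:R + setw AB.2 * lam k * (k \in AB.1)%:R.

Definition a_max (k : W) : R := \big[Num.max/0]_(AB in Mset) a_term k AB.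

(* The default value a_max k bounds every term from above, so this is the true
   minimum over the nonempty set Mset. *)
Definition a_min (k : W) : R := \big[Num.min/a_max k]_(AB in Mset) a_term k AB.

Definition a_plus (k : W) : R := a_max k / (2 * eta).
Definition a_minus (k : W) : R := a_min k / (2 * eta).

Definition sup_dist (x y : W -> R) : R := \big[Num.max/0]_(k : W) `|x k - y k|.

Section Colourings.
Variables (V : finType) (e : rel V).

Definition Hom : {set {ffun V -> W}} :=
  [set f : {ffun V -> W} | [forall u, forall v, e u v ==> eH (f u) (f v)]].

Definition colw (f : {ffun V -> W}) : R := \prod_(v : V) lam (f v).

Definition Zpart : R := \sum_(f in Hom) colw f.

Definition pcol (f : {ffun V -> W}) : R := colw f / Zpart.

Definition prob (E : pred {ffun V -> W}) : R := \sum_(f in Hom | E f) pcol f.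

Definition pbar (k : W) : R :=
  (\sum_(v : V) prob (fun f => f v == k)) / #|V|%:R.

End Colourings.

Definition colour_freq (V : finType) (f : {ffun V -> W}) (k : W) : R :=
  #|f @^-1: [set k]|%:R / #|V|%:R.

End Target.

Definition log2 (R : realType) (x : R) : R := ln x / ln 2.

Definition zeta (R : realType) (d N : nat) : R :=
  Num.max (1 / Num.sqrt d%:R) (Num.sqrt (log2 N%:R / N%:R)).

Arguments colour_freq R {W V} f k.
Arguments zeta R d N : clear implicits.

(* Main.v *)
Require Import Defs.
From mathcomp Require Import all_boot all_order all_algebra.
From mathcomp Require Import boolp reals sequences exp.
From mathcomp Require Import ring lra.

Set Implicit Arguments.
Unset Strict Implicit.
Unset Printing Implicit Defensive.

Import Order.TTheory GRing.Theory Num.Theory.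
Local Open Scope ring_scope.

(** The proof bounds an exponential moment of each colour frequency by comparing
    two partition functions, and then applies Chernoff's and Jensen's inequalities.

    Let X be one side of the bipartite graph, so that N = 2 |X|. Colouring X from
    A and the other side from B, for an optimal pair A ~ B, gives
    [eta ^ |X| <= Z] (Zpart_ge). Conversely [Z <= (eta * 2 ^ (|W| / d)) ^ |X|]
    (Zpart_le). To see this, sum out the colours of X: a vertex x whose
    neighbours carry exactly the colours D contributes the weight of the common
    neighbourhood of D, at most eta / w(D). What remains is the mean of a product
    of functions, one for each x, each seeing only the d neighbours of x, in which
    every vertex is seen by at most d of the functions. Finner's inequality
    bounds it by the product of their L^d norms. When colours are drawn
    independently with probabilities lam / L, where L is the sum of the weights, the
    palette D occurs with probability at most (w(D) / L) ^ d, so that the d-th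
    moment of 1 / w(D) is at most 2 ^ |W| / L ^ d. Finner's inequality itself
    follows by averaging one coordinate at a time and using Hölder's inequality for
    at most d functions.

    Now multiply the weight of the colour k by exp(t). The new partition
    function divided by the old one is the expectation of
    exp(t |f^-1(k)|). The first-order variation of w(A) w(B) in t is a_term,
    and the hypothesis that a_minus = a_plus = a says that all optimal pairs agree
    on it, so that eta is multiplied by at most exp(2 (a k t + K t^2)) for
    |t| <= 1/2 (eta_tilt). Together with the two bounds on Z this yields, for
    s k = |f^-1(k)| / N and a constant c = |W| ln 2 / 2,
    [E exp(t N (s k - a k)) <= exp(N (K t^2 + c / d))] (moment_le).

    For the first claim take t = eps / 2K or its opposite; when eps is at least a
    suitable multiple of 1 / sqrt d the term c / d is absorbed and the tail is at
    most exp(- eps^2 N / 8K). Distances larger than 1 do not occur. For the second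
    claim Jensen's inequality turns the moment bound into
    [t (pbar k - a k) <= K t^2 + c / d], and |t| = 1 / (2 sqrt d) gives a bound
    of order 1 / sqrt d, hence of order zeta. *)

(** * Hölder's inequality for at most d functions *)

Section Holder.
Variables (R : realType) (I : finType).

Lemma prod_powR (T : {set I}) (u : I -> R) (r : R) : (forall x, 0 <= u x) ->
  \prod_(x in T) (u x `^ r) = (\prod_(x in T) u x) `^ r.
Proof.
move=> u0.
suff [] : 0 <= \prod_(x in T) u x /\
  \prod_(x in T) (u x `^ r) = (\prod_(x in T) u x) `^ r by [].
elim/big_ind2 : _ => [|a a' b b' [a0 ->] [b0 ->]|x _]; rewrite ?ler01 ?powR1 //.
by rewrite mulr_ge0// powRM.
Qed.

(** Padding u with d - #|T| ones turns this into the inequality of arithmetic and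
    geometric means for d numbers, and so covers sets T of fewer than d indices. *)
Lemma AGM_powR (T : {set I}) (d : nat) (u : I -> R) :
    (0 < d)%N -> (#|T| <= d)%N -> (forall x, 0 <= u x) ->
  \prod_(x in T) (u x `^ d%:R^-1) <=
    (\sum_(x in T) u x + (d - #|T|)%:R) / d%:R.
Proof.
move=> d0 Td u0.
have dR : 0 < d%:R :> R by rewrite ltr0n.
have sumu0 : 0 <= \sum_(x in T) u x by apply: sumr_ge0.
have [/existsP[x /andP[xT /eqP ux]]|] := boolP [exists x in T, u x == 0].
  rewrite (bigD1 x)//= ux powR0 ?invr_eq0 ?gt_eqF// mul0r.
  by rewrite divr_ge0// addr_ge0.
rewrite negb_exists => /forallP unz.
have {unz} upos x : x \in T -> 0 < u x.
  by move=> xT; move: (unz x); rewrite xT /= lt_neqAle eq_sym u0 => ->.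
set m := _ / _.
have m0 : 0 < m.
  rewrite divr_gt0//; have [T0|] := eqVneq T set0.
    by rewrite T0 big_set0 add0r cards0 subn0.
  case/set0Pn => x xT; rewrite (bigD1 x)//= -addrA ltr_pwDl ?upos// addr_ge0//.
  exact: sumr_ge0.
have P0 : 0 < \prod_(x in T) u x by apply: prodr_gt0.
rewrite prod_powR// -ler_ln ?posrE ?powR_gt0// ln_powR.
rewrite ler_pdivrMl// -subr_ge0.
have lnprod : ln (\prod_(x in T) u x) = \sum_(x in T) ln (u x).
  suff [] : 0 < \prod_(x in T) u x /\
    ln (\prod_(x in T) u x) = \sum_(x in T) ln (u x) by [].
  elim/big_ind2 : (\prod_(x in T) u x) / (\sum_(x in T) ln (u x))
    => [|a a' b b' [a0 <-] [b0 <-]|x xT].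
  - by rewrite ln1.
  - by rewrite mulr_gt0// lnM.
  - by rewrite upos.
(* Each logarithm lies below its tangent at the mean m. *)
have tangent y : 0 < y -> ln y <= ln m + (y / m - 1).
  move=> y0; rewrite -lerBlDl -ln_div ?posrE//.
  have ym0 : 0 < y / m by rewrite divr_gt0.
  by have := @le_ln1Dx R (y / m - 1); rewrite (addrC 1) subrK; apply; lra.
have sum_le : \sum_(x in T) ln (u x) <=
    \sum_(x in T) (ln m + (u x / m - 1)).
  by apply: ler_sum => x xT; rewrite tangent// upos.
have pad : 0 <= (d - #|T|)%:R * (ln m + (1 / m - 1)).
  by rewrite mulr_ge0// -ln1 tangent.
move: sum_le; rewrite lnprod big_split/= sumr_const sumrB -mulr_suml sumr_const.
have mE : m * d%:R = \sum_(x in T) u x + (d - #|T|)%:R.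
  by rewrite /m divfK// gt_eqF.
move: mE pad; rewrite natrB// -[ln m *+ _]mulr_natr.
set S := \sum_(x in T) u x; set t := #|T|%:R; set D := d%:R => mE pad le1.
rewrite subr_ge0; apply: (le_trans le1); rewrite -subr_ge0.
have -> : S = m * D - D + t by lra.
suff -> : D * ln m - (ln m * t + ((m * D - D + t) / m - t)) =
  (D - t) * (ln m + (1 / m - 1)) by [].
by field; rewrite gt_eqF.
Qed.

(** After division by the means the claim has right-hand side 1, and then
    it is the average of the arithmetic-geometric inequality. Fewer than d
    functions may be present since the total mass is 1. *)
Lemma holder_prod (W : finType) (p : W -> R) (T : {set I}) (d : nat)
    (Phi : I -> W -> R) :
    (forall i, 0 < p i) -> \sum_i p i = 1 ->
    (0 < d)%N -> (#|T| <= d)%N -> (forall x i, 0 <= Phi x i) ->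
  \sum_i p i * \prod_(x in T) (Phi x i `^ d%:R^-1) <=
    \prod_(x in T) ((\sum_i p i * Phi x i) `^ d%:R^-1).
Proof.
move=> p0 p1 d0 Td Phi0; set A := fun x => \sum_i p i * Phi x i.
have dR : 0 < d%:R :> R by rewrite ltr0n.
have A0 x : 0 <= A x by apply: sumr_ge0 => i _; rewrite mulr_ge0// ltW.
have [/existsP[x /andP[xT /eqP Ax]]|] := boolP [exists x in T, A x == 0].
  rewrite big1 ?prodr_ge0// => [x' _|i _]; first exact: powR_ge0.
  rewrite (bigD1 x)//=; suff -> : Phi x i = 0.
    by rewrite powR0 ?invr_eq0 ?gt_eqF// mul0r mulr0.
  have pP j : true -> 0 <= p j * Phi x j by rewrite mulr_ge0// ltW.
  have /(_ pP)/eqP := @psumr_eq0P _ _ xpredT (fun j => p j * Phi x j) _ Ax i isT.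
  by rewrite mulf_eq0 gt_eqF//= => /eqP.
rewrite negb_exists => /forallP Anz.
have {Anz} Apos x : x \in T -> 0 < A x.
  by move=> xT; move: (Anz x); rewrite xT /= lt_neqAle eq_sym A0 => ->.
have PA0 : 0 < \prod_(x in T) (A x `^ d%:R^-1).
  by apply: prodr_gt0 => x xT; rewrite powR_gt0// Apos.
rewrite -[leRHS]mul1r -ler_pdivrMr//.
rewrite mulr_suml.
have one : 1 =
    \sum_i p i * ((\sum_(x in T) Phi x i / A x + (d - #|T|)%:R) / d%:R).
  under eq_bigr do rewrite mulrA mulrDr.
  rewrite -mulr_suml big_split/= -mulr_suml p1 mul1r.
  under eq_bigr do rewrite mulr_sumr.
  rewrite exchange_big/=.
  under eq_bigr => x xT.
    under eq_bigr do rewrite mulrA.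
    rewrite -mulr_suml -/(A x) divff ?gt_eqF ?Apos//. over.
  by rewrite sumr_const -natrD subnKC// divff// gt_eqF.
rewrite [leRHS]one; apply: ler_sum => i _.
rewrite -mulrA ler_wpM2l ?(ltW (p0 i))//.
rewrite -prodfV -big_split/=.
rewrite (eq_bigr (fun x => (Phi x i / A x) `^ d%:R^-1)) => [|x xT].
  by apply: AGM_powR => // x; rewrite divr_ge0.
by rewrite powRM ?invr_ge0// -[(A x)^-1]powR_inv1// powRAC powR_inv1// powR_ge0.
Qed.

End Holder.

(** * Independent random colourings and averaging over one vertex *)

Section ProductMeasure.
Variables (R : realType) (W V : finType) (p : W -> R).
Hypothesis p_gt0 : forall i, 0 < p i.
Hypothesis p_sum1 : \sum_i p i = 1.

Implicit Types (F G : {ffun V -> W} -> R) (f : {ffun V -> W}) (v : V).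

Definition recolour f v i : {ffun V -> W} :=
  [ffun u => if u == v then i else f u].

Definition mean F : R := \sum_(f : {ffun V -> W}) (\prod_v p (f v)) * F f.

Definition avg v F f : R := \sum_i p i * F (recolour f v i).

(** Integrates out the colours of the vertices in s, one after another; the result
    is still a function of the whole colouring, so that the type does not
    change along an induction on s. *)
Definition avgs (s : seq V) F : {ffun V -> W} -> R := foldr avg F s.

Definition free_of v F := forall f i, F (recolour f v i) = F f.

Lemma mean1 : mean (fun=> 1) = 1.
Proof.
rewrite /mean; under eq_bigr do rewrite mulr1.
by rewrite -(bigA_distr_bigA (fun=> p)) big1.
Qed.

Lemma prod_p_ge0 f : 0 <= \prod_v p (f v).
Proof. by rewrite prodr_ge0// => v _; rewrite ltW. Qed.

Lemma le_mean F G : (forall f, F f <= G f) -> mean F <= mean G.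
Proof. by move=> FG; apply: ler_sum => f _; rewrite ler_wpM2l ?prod_p_ge0. Qed.

Lemma mean_ge0 F : (forall f, 0 <= F f) -> 0 <= mean F.
Proof. by move=> F0; apply: sumr_ge0 => f _; rewrite mulr_ge0 ?prod_p_ge0. Qed.

Lemma meanZ c F : mean (fun f => c * F f) = c * mean F.
Proof. by rewrite /mean mulr_sumr; apply: eq_bigr => f _; rewrite mulrCA. Qed.

Lemma mean_cst c : mean (fun=> c) = c.
Proof.
by rewrite -[RHS]mulr1 -mean1 -meanZ; congr mean; apply/funext => f; rewrite mulr1.
Qed.

(** Resampling one coordinate does not change the law: exchanging the colour of
    v with the fresh colour is a weight-preserving involution on pairs. *)
Lemma mean_avg v F : mean (avg v F) = mean F.
Proof.
pose swap (fi : {ffun V -> W} * W) := (recolour fi.1 v fi.2, fi.1 v).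
have swapK : involutive swap.
  move=> [f i]; rewrite /swap /= ffunE eqxx; congr (_, _).
  by apply/ffunP => u; rewrite !ffunE; case: eqP => [->|].
pose w (fi : {ffun V -> W} * W) := (\prod_u p (fi.1 u)) * p fi.2.
have w_swap fi : w (swap fi) = w fi.
  case: fi => f i; rewrite /w /swap /= (bigD1 v)//= [in RHS](bigD1 v)//= ffunE eqxx.
  rewrite (eq_bigr (fun u => p (f u))) => [|u /negPf uv]; last by rewrite ffunE uv.
  by rewrite mulrAC [in RHS]mulrAC [p i * _]mulrC.
transitivity (\sum_fi w fi * F (swap fi).1).
  rewrite -(pair_bigA _ (fun f i => w (f, i) * F (swap (f, i)).1))/=.
  by apply: eq_bigr => f _; rewrite mulr_sumr; apply: eq_bigr => i _; rewrite mulrA.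
rewrite (reindex_inj (inv_inj swapK)).
rewrite (eq_bigr (fun fi => w fi * F fi.1)) => [|fi _]; last by rewrite w_swap swapK.
rewrite -(pair_bigA _ (fun f i => w (f, i) * F f))/=.
apply: eq_bigr => f _; rewrite -mulr_suml; congr (_ * _).
by rewrite /w /= -mulr_sumr p_sum1 mulr1.
Qed.

Lemma mean_avgs s F : mean (avgs s F) = mean F.
Proof. by elim: s => //= v s <-; exact: mean_avg. Qed.

Lemma recolourC f u v i j : u != v ->
  recolour (recolour f u i) v j = recolour (recolour f v j) u i.
Proof.
move=> uv; apply/ffunP => z; rewrite !ffunE.
by case: eqP => [->|//]; rewrite eq_sym (negPf uv).
Qed.

Lemma avg_ge0 v F : (forall f, 0 <= F f) -> forall f, 0 <= avg v F f.
Proof. by move=> F0 f; apply: sumr_ge0 => i _; rewrite mulr_ge0// ltW. Qed.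

Lemma avgs_ge0 s F : (forall f, 0 <= F f) -> forall f, 0 <= avgs s F f.
Proof. by move=> F0; elim: s => //= v s IH; exact: avg_ge0. Qed.

Lemma avg_free v F : free_of v F -> avg v F = F.
Proof.
move=> Fv; apply/funext => f; rewrite /avg.
by under eq_bigr do rewrite Fv; rewrite -mulr_suml p_sum1 mul1r.
Qed.

Lemma free_avg_self v F : free_of v (avg v F).
Proof.
move=> f i; apply: eq_bigr => j _; congr (_ * F _).
by apply/ffunP => u; rewrite !ffunE; case: eqP.
Qed.

Lemma free_avg u v F : free_of v F -> free_of v (avg u F).
Proof.
have [->|uv] := eqVneq u v; first by move=> _; exact: free_avg_self.
by move=> Fv f i; apply: eq_bigr => j _; rewrite recolourC ?Fv// eq_sym.
Qed.

Lemma free_avgs s v F : free_of v F -> free_of v (avgs s F).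
Proof. by move=> Fv; elim: s => //= u s; exact: free_avg. Qed.

Lemma free_avgs_in s v F : v \in s -> free_of v (avgs s F).
Proof.
elim: s => //= u s IH; rewrite inE => /orP[/eqP->|/IH]; first exact: free_avg_self.
exact: free_avg.
Qed.

Lemma avgs_single s x F : uniq s -> x \in s ->
  (forall v, v \in s -> v != x -> free_of v F) -> avgs s F = avg x F.
Proof.
elim: s => //= u s IH /andP[us uniqs] xs Fs.
have [ux|ux] := eqVneq u x.
  rewrite -ux; congr avg; elim: s us {uniqs IH xs} Fs => //= v s IH.
  rewrite inE negb_or => /andP[uv us] Fs.
  rewrite IH// => [|z zs zx].
    by apply/avg_free/Fs; rewrite ?inE ?eqxx ?orbT// -ux eq_sym.
  by apply: Fs => //; move: zs; rewrite !inE => /orP[->|->]//; rewrite !orbT.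
move: xs; rewrite inE eq_sym (negPf ux)/= => xs.
rewrite IH// => [|v vs]; last by apply: Fs; rewrite inE vs orbT.
by apply/avg_free/free_avg/Fs; rewrite ?inE ?eqxx.
Qed.

Lemma free_all_eq F : (forall v, free_of v F) -> forall f g, F f = F g.
Proof.
move=> Ffree f g.
suff H (s : seq V) : F [ffun u => if u \in s then g u else f u] = F f.
  by rewrite -(H (enum V)); congr F; apply/ffunP => u; rewrite ffunE mem_enum.
elim: s => [|v s <-]; first by congr F; apply/ffunP => u; rewrite ffunE.
rewrite -[RHS](Ffree v _ (g v)); congr F; apply/ffunP => u.
by rewrite !ffunE inE; case: eqP => [->|].
Qed.

Lemma avgs_enum F f : avgs (enum V) F f = mean F.
Proof.
rewrite -(mean_avgs (enum V) F).
rewrite (_ : avgs (enum V) F = fun=> avgs (enum V) F f) ?mean_cst//.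
apply/funext => g; apply: free_all_eq => v.
by apply: free_avgs_in; rewrite mem_enum.
Qed.

(** * Finner's inequality *)

Section Finner.
Variables (I : finType) (X : {set I}) (S : I -> {set V}) (d : nat).
Hypothesis d_gt0 : (0 < d)%N.

(** Given the other colours, Hölder's inequality applies to the at most d
    factors that see v; the other factors are fixed by the averaging. *)
Lemma finner_step v (Phi : I -> {ffun V -> W} -> R) :
    (forall x f, 0 <= Phi x f) ->
    (forall x, v \notin S x -> free_of v (Phi x)) ->
    (#|[set x in X | v \in S x]| <= d)%N ->
  mean (fun f => \prod_(x in X) (Phi x f `^ d%:R^-1)) <=
  mean (fun f => \prod_(x in X) (avg v (Phi x) f `^ d%:R^-1)).
Proof.
move=> Phi0 Phifree vd; rewrite -(mean_avg v); apply: le_mean => f.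
pose T := [set x in X | v \in S x].
pose rest := \prod_(x in X | v \notin S x) (Phi x f `^ d%:R^-1).
have split_prod (F : I -> R) : (forall x, v \notin S x -> F x = Phi x f) ->
    \prod_(x in X) (F x `^ d%:R^-1) = rest * \prod_(x in T) (F x `^ d%:R^-1).
  move=> FE; rewrite (bigID (fun x => v \notin S x))/=; congr (_ * _).
    by apply: eq_bigr => x /andP[_ /FE->].
  by apply: eq_bigl => x; rewrite inE negbK.
rewrite [leRHS]split_prod => [|x /Phifree/avg_free->//].
rewrite /avg (eq_bigr (fun i => rest *
    (p i * \prod_(x in T) (Phi x (recolour f v i) `^ d%:R^-1)))) => [|i _]; last first.
  by rewrite split_prod 1?mulrCA// => x /Phifree.
rewrite -mulr_sumr ler_wpM2l//.
  by rewrite prodr_ge0// => x _; exact: powR_ge0.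
exact: (holder_prod p_gt0 p_sum1 d_gt0 vd).
Qed.

(** Only the vertices of s need to be seen by at most d functions. The case d = 1
    says that factors sharing no vertex of s may be averaged separately. *)
Lemma finner_avgs s (Phi : I -> {ffun V -> W} -> R) :
    (forall x f, 0 <= Phi x f) ->
    (forall x v, v \notin S x -> free_of v (Phi x)) ->
    (forall v, v \in s -> (#|[set x in X | v \in S x]| <= d)%N) ->
  mean (fun f => \prod_(x in X) (Phi x f `^ d%:R^-1)) <=
  mean (fun f => \prod_(x in X) (avgs s (Phi x) f `^ d%:R^-1)).
Proof.
move=> Phi0 Phifree; elim: s => //= v s IH sd.
apply: (le_trans (IH _)) => [u us|]; first by rewrite sd// inE us orbT.
apply: finner_step => [x|x /Phifree|].
- exact: avgs_ge0.
- exact: free_avgs.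
- by rewrite sd// inE eqxx.
Qed.

(** Once every vertex is averaged the factors are constants, namely their means. *)
Lemma finner (Phi : I -> {ffun V -> W} -> R) :
    (forall x f, 0 <= Phi x f) ->
    (forall x v, v \notin S x -> free_of v (Phi x)) ->
    (forall v, (#|[set x in X | v \in S x]| <= d)%N) ->
  mean (fun f => \prod_(x in X) (Phi x f `^ d%:R^-1)) <=
  \prod_(x in X) (mean (Phi x) `^ d%:R^-1).
Proof.
move=> Phi0 Phifree dX.
apply: (le_trans (finner_avgs (s := enum V) Phi0 Phifree (fun v _ => dX v))).
rewrite -[leRHS]mean_cst; apply: le_mean => f.
by rewrite le_eqVlt; apply/orP; left; apply/eqP/eq_bigr => x _; rewrite avgs_enum.
Qed.

End Finner.

End ProductMeasure.

(** * The partition function of a regular bipartite graph *)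

Lemma ler_sum_subpred (R : realType) (I : finType) (P Q : pred I) (F : I -> R) :
  (forall i, 0 <= F i) -> (forall i, P i -> Q i) ->
  \sum_(i | P i) F i <= \sum_(i | Q i) F i.
Proof.
move=> F0 PQ; rewrite big_mkcond [leRHS]big_mkcond; apply: ler_sum => i _.
by case: ifP => [/PQ->//|_]; case: ifP.
Qed.

Section Eta.
Variables (R : realType) (W : finType) (eH : rel W).
Hypothesis eH_sym : symmetric eH.
Hypothesis eH_edge : exists i j : W, eH i j.
Variable lam : W -> R.
Hypothesis lam_gt0 : forall i, 0 < lam i.

Lemma setw_ge0 A : 0 <= setw lam A.
Proof. by apply: sumr_ge0 => i _; rewrite ltW. Qed.

Lemma setw_gt0 (A : {set W}) i : i \in A -> 0 < setw lam A.
Proof.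
move=> iA; rewrite /setw (bigD1 i)//= ltr_pwDl// sumr_ge0// => j _.
by rewrite ltW.
Qed.

Lemma le_setw_lam (A : {set W}) i : i \in A -> lam i <= setw lam A.
Proof.
by move=> iA; rewrite /setw (bigD1 i)//= lerDl sumr_ge0// => j _; rewrite ltW.
Qed.

Lemma le_eta A B : complete_to eH A B -> setw lam A * setw lam B <= eta eH lam.
Proof.
move=> AB; exact: (@le_bigmax_cond _ _ _ 0 (A, B)
  (fun AB => complete_to eH AB.1 AB.2) (fun AB => setw lam AB.1 * setw lam AB.2)).
Qed.

Lemma eta_gt0 : 0 < eta eH lam.
Proof.
have [i [j ij]] := eH_edge.
have AB : complete_to eH [set i] [set j].
  by apply/forall_inP => u /set1P->; apply/forall_inP => v /set1P->.
apply: lt_le_trans (le_eta AB); rewrite mulr_gt0//.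
  by apply: (@setw_gt0 _ i); rewrite inE.
by apply: (@setw_gt0 _ j); rewrite inE.
Qed.

Lemma Mset_nonempty : exists AB, AB \in Mset eH lam.
Proof.
have P0 : complete_to eH (set0, set0 : {set W}).1 (set0 : {set W}, set0 : {set W}).2.
  by apply/forall_inP => u; rewrite inE.
have [|AB PAB E] := @eq_bigmax _ _ _ 0 (set0, set0)
  (fun AB => complete_to eH AB.1 AB.2) (fun AB => setw lam AB.1 * setw lam AB.2) P0.
  by move=> AB _; rewrite mulr_ge0 ?setw_ge0.
by exists AB; rewrite inE; apply/andP; split => //; rewrite /eta E.
Qed.

Section Graph.
Variables (V : finType) (e : rel V) (d : nat) (X : {set V}).
Hypothesis e_sym : symmetric e.
Hypothesis e_reg : regular e d.
Hypothesis d_gt0 : (0 < d)%N.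
Hypothesis e_bip : forall u v, e u v -> (u \in X) != (v \in X).

Lemma card_side : #|~: X| = #|X|.
Proof.
suff E : (\sum_(u in X) \sum_(v | e u v) 1 = \sum_(u in ~: X) \sum_(v | e u v) 1)%N.
  have deg (Y : {set V}) : (\sum_(u in Y) \sum_(v | e u v) 1 = #|Y| * d)%N.
    rewrite -sum_nat_const; apply: eq_bigr => u _.
    by rewrite sum1_card -(e_reg u) cardsE.
  by move: E; rewrite !deg => /eqP; rewrite eqn_pmul2r// => /eqP.
rewrite (exchange_big_dep (fun v => v \in ~: X))/= => [|u v uX /e_bip].
  by apply: eq_bigr => v vX; apply: eq_bigl => u; move: vX; rewrite inE e_sym;
     case E: (e v u); rewrite ?andbF ?andbT//; move/e_bip: E;
     case: (v \in X); case: (u \in X).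
by rewrite uX inE; case: (v \in X).
Qed.

Lemma card_V : #|V| = (#|X| + #|X|)%N.
Proof. by rewrite -{2}card_side cardsC. Qed.

Lemma sum_colw_family (Q : V -> {set W}) :
  \sum_(f in family Q) colw lam f = \prod_v setw lam (Q v).
Proof. by rewrite bigA_distr_big_dep. Qed.

Lemma colw_gt0 (f : {ffun V -> W}) : 0 < colw lam f.
Proof. by apply: prodr_gt0. Qed.

(** All maps that send X into A and its complement into B, for an optimal pair
    (A, B), are colourings; their weights add up to eta ^ #|X|. *)
Lemma Zpart_ge : eta eH lam ^+ #|X| <= Zpart eH lam e.
Proof.
have [[A B]] := Mset_nonempty; rewrite inE/= => /andP[AB /eqP <-].
pose Q v := if v \in X then A else B.
have -> : (setw lam A * setw lam B) ^+ #|X| = \prod_v setw lam (Q v).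
  rewrite exprMn -{2}card_side -!prodr_const [RHS](bigID (mem X))/=; congr (_ * _).
    by apply: eq_bigr => v vX; rewrite /Q vX.
  by apply: eq_big => [v|v]; rewrite !inE// /Q => /negPf->.
rewrite -sum_colw_family; apply: ler_sum_subpred => [f|f /familyP fQ].
  by rewrite ltW ?colw_gt0.
rewrite inE; apply/forallP => u; apply/forallP => v; apply/implyP => /e_bip.
move: (fQ u) (fQ v); rewrite /Q; do 2!case: ifP => //= _; move=> fu fv _.
  by move/forall_inP/(_ _ fu)/forall_inP/(_ _ fv): AB.
by rewrite eH_sym; move/forall_inP/(_ _ fv)/forall_inP/(_ _ fu): AB.
Qed.

Definition total : R := \sum_i lam i.

Definition plaw i : R := lam i / total.

Lemma total_gt0 : 0 < total.
Proof.
have [i _] := eH_edge; rewrite /total (bigD1 i)//= ltr_pwDl// sumr_ge0// => j _.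
by rewrite ltW.
Qed.

Lemma plaw_gt0 i : 0 < plaw i.
Proof. by rewrite divr_gt0// total_gt0. Qed.

Lemma plaw_sum1 : \sum_i plaw i = 1.
Proof. by rewrite -mulr_suml divff// gt_eqF// total_gt0. Qed.

Lemma plaw_setw (A : {set W}) : \sum_(i in A) plaw i = setw lam A / total.
Proof. by rewrite -mulr_suml. Qed.

Lemma Zpart_mean :
  Zpart eH lam e = total ^+ #|V| * mean plaw (fun f => (f \in Defs.Hom eH e)%:R).
Proof.
rewrite /mean mulr_sumr /Zpart big_mkcond/=; apply: eq_bigr => f _.
have -> : \prod_v plaw (f v) = colw lam f / total ^+ #|V|.
  by rewrite /plaw big_split/= prodr_const exprVn.
rewrite mulrA [_ * (_ / _)]mulrC divfK ?expf_neq0 ?gt_eqF ?total_gt0//.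
by case: ifP; rewrite ?mulr1 ?mulr0.
Qed.

(** The part of the colouring condition that sees x in X; as X meets every edge
    once, these parts share no vertex of X. *)
Definition local_hom x (f : {ffun V -> W}) : R :=
  [forall y, e x y ==> eH (f x) (f y)]%:R.

Lemma Hom_local (f : {ffun V -> W}) :
  (f \in Defs.Hom eH e)%:R = \prod_(x in X) local_hom x f.
Proof.
have [fH|fH] := boolP (f \in Defs.Hom eH e).
  rewrite big1// => x _; rewrite /local_hom; move: fH; rewrite inE.
  by move=> /forallP/(_ x)->.
move: fH; rewrite inE negb_forall => /existsP[u].
rewrite negb_forall => /existsP[v]; rewrite negb_imply => /andP[uv fuv].
have [x [y [xX xy fxy]]] : exists x y, [/\ x \in X, e x y & ~~ eH (f x) (f y)].
  have := e_bip uv; case uX: (u \in X); first by exists u, v.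
  by case vX: (v \in X) => // _; exists v, u; rewrite e_sym eH_sym.
rewrite (bigD1 x)//= (_ : local_hom x f = 0) ?mul0r// /local_hom.
case: forallP => // /(_ y); rewrite xy/=; first by rewrite (negPf fxy).
Qed.

Definition nbhd x : {set V} := [set y | e x y].

Definition palette (f : {ffun V -> W}) x : {set W} := f @: nbhd x.

Lemma nbhd_neq x y : x \in X -> y \in nbhd x -> y \notin X.
Proof. by move=> xX; rewrite inE => /e_bip; rewrite xX; case: (y \in X). Qed.

Lemma palette_setw_gt0 f x : 0 < setw lam (palette f x).
Proof.
have: (0 < #|nbhd x|)%N by rewrite (e_reg x).
case/card_gt0P => y yx; apply: (@setw_gt0 _ (f y)).
exact: imset_f.
Qed.

Lemma recolour_free_nbhd (f : {ffun V -> W}) x v i : v \notin nbhd x ->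
  palette (recolour f v i) x = palette f x.
Proof.
move=> vx; apply: eq_in_imset => y yx; rewrite ffunE.
by case: eqP yx vx => // -> ->.
Qed.

(** The colours allowed at x form a set B with B ~ palette f x, whose weight is
    therefore at most eta divided by the weight of the palette. *)
Lemma avg_local_hom x f : x \in X ->
  avg plaw x (local_hom x) f <=
    eta eH lam / total * (setw lam (palette f x))^-1.
Proof.
move=> xX; pose B := [set i | [forall y, e x y ==> eH i (f y)]].
have -> : avg plaw x (local_hom x) f = setw lam B / total.
  rewrite -plaw_setw [RHS]big_mkcond/=; apply: eq_bigr => i _.
  rewrite /local_hom inE (eq_forallb (_ : _ =1 fun y => e x y ==> eH i (f y))).
    by case: ifP; rewrite ?mulr1 ?mulr0.
  move=> y; have [xy|//] := boolP (e x y); rewrite !ffunE eqxx/=.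
  by case: eqP xy => // -> /e_bip; rewrite eqxx.
rewrite mulrAC ler_pM2r ?invr_gt0 ?total_gt0// ler_pdivlMr ?palette_setw_gt0//.
apply: le_eta; apply/forall_inP => i; rewrite inE => /forallP iB.
apply/forall_inP => j /imsetP[y]; rewrite inE => xy ->.
by move: (iB y); rewrite xy.
Qed.

(** Partition according to the palette D; the neighbours of x are
    independent, so they all take colours in D with probability
    (w(D) / total) ^ d, which cancels the weight. *)
Lemma mean_palette x :
  mean plaw (fun f => (setw lam (palette f x))^-1 ^+ d) <=
    total^-1 ^+ d * 2 ^+ #|W|.
Proof.
rewrite /mean (partition_big (fun f => palette f x) xpredT)//=.
have -> : total^-1 ^+ d * 2 ^+ #|W| = \sum_(D : {set W}) total^-1 ^+ d.
  rewrite sumr_const -[RHS]mulr_natr; congr (_ * _).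
  by rewrite -natrX -[#|W|]cardsT -card_powerset powersetT cardsT.
apply: ler_sum => D _.
have [->|/set0Pn[i iD]] := eqVneq D set0.
  rewrite big1 ?exprn_ge0 ?invr_ge0 ?ltW ?total_gt0// => f /eqP E.
  by have := palette_setw_gt0 f x; rewrite E /setw big_set0 ltxx.
have D0 := setw_gt0 iD.
under eq_bigr => f /eqP-> do [].
rewrite -mulr_suml -ler_pdivlMr ?exprn_gt0 ?invr_gt0// -exprVn invrK -exprMn.
pose Q y : {set W} := if y \in nbhd x then D else setT.
have -> : (total^-1 * setw lam D) ^+ d = \prod_y \sum_(i in Q y) plaw i.
  rewrite [RHS](bigID (mem (nbhd x)))/= [X in _ = _ * X]big1
    => [|y /negPf yx]; last first.
    by rewrite /Q yx -plaw_sum1; apply: eq_bigl => j; rewrite inE.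
  rewrite mulr1 [RHS](eq_bigr (fun=> total^-1 * setw lam D)) => [|y yx]; last first.
    by rewrite /Q yx plaw_setw mulrC.
  by rewrite prodr_const (e_reg x).
rewrite bigA_distr_big_dep/=; apply: ler_sum_subpred => [f|f /eqP fD].
  exact: (prod_p_ge0 plaw_gt0).
apply/familyP => y; rewrite /Q; case: ifP => // yx.
by rewrite -fD; apply: imset_f.
Qed.

(** The classical bound by complete bipartite graphs K_(d,d), except that the
    number of colourings of K_(d,d) is replaced by its upper bound
    eta ^ d * 2 ^ #|W|. *)
Lemma Zpart_le :
  Zpart eH lam e <= (eta eH lam * (2 ^+ #|W|) `^ d%:R^-1) ^+ #|X|.
Proof.
have p0 := plaw_gt0; have p1 := plaw_sum1.
have L0 := total_gt0; have dR : d%:R != 0 :> R by rewrite pnatr_eq0 -lt0n.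
pose B f x := (setw lam (palette f x))^-1.
have B0 f x : 0 <= B f x by rewrite invr_ge0 ltW// palette_setw_gt0.
have sum_out_X : mean plaw (fun f => (f \in Defs.Hom eH e)%:R) <=
    mean plaw (fun f => \prod_(x in X) avg plaw x (local_hom x) f).
  have lh0 x f : 0 <= local_hom x f by rewrite /local_hom.
  have free x v : v \notin x |: nbhd x -> free_of v (local_hom x).
    rewrite !inE negb_or => /andP[vx vnx] f i; rewrite /local_hom.
    congr (nat_of_bool _)%:R; apply: eq_forallb => y.
    rewrite !ffunE eq_sym (negPf vx); case: eqP => [->|//].
    by rewrite (negPf vnx).
  have card1 v : v \in enum X -> (#|[set x in X | v \in x |: nbhd x]| <= 1)%N.
    rewrite mem_enum => vX; rewrite -(cards1 v); apply/subset_leq_card/subsetP => x.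
    rewrite !inE => /andP[xX /orP[/eqP->//|/e_bip]]; rewrite xX vX//.
  apply: (le_trans (le_mean p0 _)
    (le_trans (finner_avgs p0 p1 (ltnSn 0) lh0 free card1) (le_mean p0 _))) => f /=.
    by rewrite Hom_local; under [leRHS]eq_bigr do rewrite invr1 powRr1//.
  rewrite le_eqVlt; apply/orP; left; apply/eqP; apply: eq_bigr => x xX.
  rewrite invr1 powRr1; last exact: (avgs_ge0 p0).
  rewrite (avgs_single p1 (x := x)) ?enum_uniq ?mem_enum// => v.
  rewrite mem_enum => vX vx; apply: free; rewrite in_setU1 (negPf vx)/=.
  by apply: contraL vX; exact: nbhd_neq.
have palettes : mean plaw (fun f => \prod_(x in X) avg plaw x (local_hom x) f) <=
    (eta eH lam / total) ^+ #|X| * mean plaw (fun f => \prod_(x in X) B f x).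
  rewrite -meanZ; apply: (le_mean p0) => f.
  rewrite -prodr_const -big_split/=; apply: ler_prod => x xX.
  by rewrite avg_local_hom// andbT; apply: (avg_ge0 p0) => g; rewrite /local_hom.
have holder : mean plaw (fun f => \prod_(x in X) B f x) <=
    (total^-1 * (2 ^+ #|W|) `^ d%:R^-1) ^+ #|X|.
  have powK (y : R) : 0 <= y -> (y ^+ d) `^ d%:R^-1 = y.
    by move=> y0; rewrite -powR_mulrn// -powRrM mulfV// powRr1.
  have Phi0 x f : 0 <= B f x ^+ d by rewrite exprn_ge0.
  have free x v : v \notin nbhd x -> free_of v (fun f => B f x ^+ d).
    by move=> vx f i; rewrite /B recolour_free_nbhd.
  have card_d v : (#|[set x in X | v \in nbhd x]| <= d)%N.
    rewrite -(e_reg v); apply/subset_leq_card/subsetP => x.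
    by rewrite !inE e_sym => /andP[].
  have := finner p0 p1 d_gt0 Phi0 free card_d.
  under eq_fun do under eq_bigr do rewrite powK//.
  move=> /le_trans; apply; rewrite -prodr_const; apply: ler_prod => x _.
  have L0' := ltW L0.
  rewrite powR_ge0/= -[total^-1]powK ?invr_ge0// -powRM ?exprn_ge0 ?invr_ge0//.
  apply: ge0_ler_powR; rewrite ?nnegrE ?invr_ge0//; last exact: mean_palette.
    by apply: (mean_ge0 p0) => f; exact: Phi0.
  by rewrite mulr_ge0 ?exprn_ge0 ?invr_ge0.
rewrite Zpart_mean -ler_pdivlMl ?exprn_gt0//.
apply: (le_trans sum_out_X); apply: (le_trans palettes).
apply: (le_trans (ler_wpM2l _ holder)).
  by rewrite exprn_ge0// divr_ge0 ?ltW ?eta_gt0.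
rewrite card_V exprD -!exprMn -exprVn -exprMn le_eqVlt; apply/orP; left; apply/eqP.
congr (_ ^+ _); field; exact: lt0r_neq0.
Qed.

End Graph.
End Eta.

(** * Tilting the weight of one colour *)

Section Tilt.
Variables (R : realType) (W : finType) (eH : rel W).
Hypothesis eH_edge : exists i j : W, eH i j.
Variable lam : W -> R.
Hypothesis lam_gt0 : forall i, 0 < lam i.
Variable a : W -> R.
Hypothesis a_min_max :
  forall k : W, a_minus eH lam k = a k /\ a_plus eH lam k = a k.

Definition tilt k (t : R) j : R := lam j * expR (t * (j == k)%:R).

Lemma tilt_gt0 k t j : 0 < tilt k t j.
Proof. by rewrite mulr_gt0// expR_gt0. Qed.

(** As minimum and maximum of a_term over the optimal pairs coincide, a_term is
    constant on them. *)
Lemma a_term_Mset k AB : AB \in Mset eH lam ->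
  a_term lam k AB = 2 * eta eH lam * a k.
Proof.
move=> ABM; have [amin amax] := a_min_max k.
have eta0 : 2 * eta eH lam != 0.
  by rewrite mulf_neq0 ?pnatr_eq0// gt_eqF// (eta_gt0 eH_edge lam_gt0).
have emax : a_max eH lam k = 2 * eta eH lam * a k.
  by rewrite -amax mulrC divfK.
have emin : a_min eH lam k = 2 * eta eH lam * a k.
  by rewrite -amin mulrC divfK.
apply/eqP; rewrite eq_le -{1}emax -emin.
by rewrite le_bigmax_cond//= bigmin_le_cond.
Qed.

Lemma a_itv k : 0 <= a k <= 1.
Proof.
have eta0 := eta_gt0 eH_edge lam_gt0.
have [[A B] ABM] := Mset_nonempty eH lam_gt0.
have := a_term_Mset k ABM; move: ABM; rewrite inE/= => /andP[_ /eqP ABe].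
have A0 := setw_ge0 lam_gt0 A; have B0 := setw_ge0 lam_gt0 B.
have l0 := ltW (lam_gt0 k).
have bound (C D : {set W}) :
    0 <= setw lam C * lam k * (k \in D)%:R <= setw lam C * setw lam D.
  have C0 := setw_ge0 lam_gt0 C; have D0 := setw_ge0 lam_gt0 D.
  case kD: (k \in D); rewrite ?mulr0 ?mulr1 ?lexx ?mulr_ge0//=.
  by rewrite ler_wpM2l// le_setw_lam.
have /andP[a1 a2] := bound A B; have /andP[b1 b2] := bound B A.
rewrite /a_term/= => aE.
rewrite -(pmulr_rge0 _ (_ : 0 < 2 * eta eH lam)) ?mulr_gt0// -aE addr_ge0//=.
rewrite -(ler_pM2l (_ : 0 < 2 * eta eH lam)) ?mulr_gt0// -aE mulr1 mulr2n mulrDl mul1r.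
by rewrite -ABe lerD// [leRHS]mulrC.
Qed.

Lemma expR_le_quadratic (t : R) : `|t| <= 2^-1 -> expR t - 1 <= t + 2 * t ^+ 2.
Proof.
rewrite ler_norml => /andP[t1 t2].
have : (1 - t) * expR t <= 1.
  rewrite -[leRHS](expRxMexpNx_1 t) mulrC ler_wpM2l ?expR_ge0//.
  exact: expR_ge1Dx.
have := expR_gt0 t; set x := expR t => x0 tx.
have t1' : 0 < 1 - t by lra.
rewrite lerBlDr -(ler_pM2l t1'); apply: (le_trans tx).
have : 0 <= t ^+ 2 * (1 - 2 * t) by rewrite mulr_ge0 ?sqr_ge0//; lra.
nra.
Qed.

Lemma setw_tilt k t A :
  setw (tilt k t) A = setw lam A + (expR t - 1) * (lam k * (k \in A)%:R).
Proof.
have [kA|kA] := boolP (k \in A).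
  rewrite /setw (bigD1 k)//= [X in _ = X + _](bigD1 k)//= /tilt eqxx !mulr1.
  rewrite (eq_bigr lam) => [|i /andP[_ /negPf->]]; last by rewrite mulr0 expR0 mulr1.
  by ring.
rewrite !mulr0 addr0; apply: eq_bigr => i iA; rewrite /tilt.
by case: eqP iA kA => [->->//|_ _ _]; rewrite mulr0 expR0 mulr1.
Qed.

Lemma setw_tilt_le k t A : setw (tilt k t) A <= expR `|t| * setw lam A.
Proof.
rewrite mulr_sumr; apply: ler_sum => i _.
rewrite /tilt mulrC ler_wpM2r ?(ltW (lam_gt0 i))//.
rewrite ler_expR; case: eqP => _; rewrite ?mulr1 ?mulr0//; exact: ler_norm.
Qed.

(** For an optimal pair the derivative of log w(A)w(B) at t = 0 is
    a_term / eta = 2 a k. *)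
Lemma tilt_optimal k t AB : `|t| <= 2^-1 -> AB \in Mset eH lam ->
  setw (tilt k t) AB.1 * setw (tilt k t) AB.2 <=
    eta eH lam * expR (2 * (a k * t + 2 * t ^+ 2)).
Proof.
move=> t2 ABM; have aE := a_term_Mset k ABM.
have eta0 := eta_gt0 eH_edge lam_gt0.
have /andP[a0 a1] := a_itv k.
move: ABM aE; case: AB => A B; rewrite inE/= /a_term/= => /andP[_ /eqP ABe] aE.
have A0 : 0 < setw lam A.
  rewrite lt_neqAle setw_ge0// andbT eq_sym.
  by apply: contraTneq eta0 => A0; rewrite -ABe A0 mul0r ltxx.
have B0 : 0 < setw lam B.
  rewrite lt_neqAle setw_ge0// andbT eq_sym.
  by apply: contraTneq eta0 => B0; rewrite -ABe B0 mulr0 ltxx.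
set s := expR t - 1.
have factor (C : {set W}) : 0 < setw lam C -> setw (tilt k t) C <=
    setw lam C * expR (s * (lam k * (k \in C)%:R / setw lam C)).
  move=> C0; rewrite setw_tilt -/s.
  have -> : setw lam C + s * (lam k * (k \in C)%:R) =
    setw lam C * (1 + s * (lam k * (k \in C)%:R / setw lam C)).
    by field; rewrite gt_eqF.
  by rewrite ler_pM2l// expR_ge1Dx.
have T0 C : 0 <= setw (tilt k t) C by apply: setw_ge0; exact: tilt_gt0.
apply: (le_trans (ler_pM (T0 A) (T0 B) (factor A A0) (factor B B0))).
rewrite mulrACA ABe -expRD ler_pM2l// ler_expR.
have -> : s * (lam k * (k \in A)%:R / setw lam A) +
    s * (lam k * (k \in B)%:R / setw lam B) = s * (2 * a k).
  rewrite -mulrDr; congr (_ * _); apply: (mulfI (lt0r_neq0 eta0)).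
  rewrite [RHS]mulrA [eta _ _ * 2]mulrC -aE -ABe; field.
  by rewrite !gt_eqF.
have := expR_le_quadratic t2; rewrite -/s => sle.
have : s * a k <= (t + 2 * t ^+ 2) * a k by rewrite ler_wpM2r.
have : t ^+ 2 * a k <= t ^+ 2 by rewrite ler_piMr// sqr_ge0.
lra.
Qed.

(** A pair that is not optimal stays behind for small t because of its
    gap g = ln (eta / w(A) w(B)); for larger t the quadratic term with constant
    2 / g absorbs the linear one. *)
Lemma tilt_suboptimal AB : complete_to eH AB.1 AB.2 -> AB \notin Mset eH lam ->
  exists2 K, 0 <= K & forall k t,
    setw (tilt k t) AB.1 * setw (tilt k t) AB.2 <=
      eta eH lam * expR (2 * (a k * t + K * t ^+ 2)).
Proof.
case: AB => A B /= AB; rewrite inE/= AB/= => ABe.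
have eta0 := eta_gt0 eH_edge lam_gt0.
have A0 := setw_ge0 lam_gt0 A; have B0 := setw_ge0 lam_gt0 B.
have T0 k t C : 0 <= setw (tilt k t) C by apply: setw_ge0; exact: tilt_gt0.
have le2 k t : setw (tilt k t) A * setw (tilt k t) B <=
    setw lam A * setw lam B * expR (2 * `|t|).
  apply: (le_trans (ler_pM (T0 k t A) (T0 k t B)
    (setw_tilt_le k t A) (setw_tilt_le k t B))).
  by rewrite mulrACA mulrC -expRD mulr2n mulrDl mul1r.
set q := setw lam A * setw lam B in ABe le2.
have qlt : q < eta eH lam by rewrite lt_neqAle ABe le_eta.
have : 0 <= q by rewrite mulr_ge0.
rewrite le_eqVlt => /orP[/eqP q0|q0].
  exists 0 => // k t; apply: (le_trans (le2 k t)); rewrite -q0 mul0r.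
  by rewrite mulr_ge0 ?expR_ge0// ltW.
pose g := ln (eta eH lam / q).
have g0 : 0 < g by rewrite ln_gt0// ltr_pdivlMr// mul1r.
have etaE : eta eH lam = q * expR g.
  by rewrite lnK ?posrE ?divr_gt0// mulrC divfK// gt_eqF.
exists (2 / g); first by rewrite divr_ge0 ?ltW.
move=> k t; apply: (le_trans (le2 k t)).
rewrite etaE -mulrA ler_pM2l// -expRD ler_expR.
have /andP[a0 a1] := a_itv k.
have at_ge : - `|t| <= a k * t.
  rewrite lerNl -mulrN (le_trans (ler_norm _))// normrM normrN ger0_norm//.
  by rewrite ler_piMl.
have sq : 4 * `|t| <= g + 2 * (2 / g * t ^+ 2).
  rewrite -subr_ge0 (_ : _ - _ = (g - 2 * `|t|) ^+ 2 / g).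
    by rewrite divr_ge0 ?sqr_ge0 ?ltW.
  by rewrite -(real_normK (num_real t)); field; rewrite gt_eqF.
lra.
Qed.

Lemma eta_tilt : exists2 K, 1 <= K & forall k (t : R), `|t| <= 2^-1 ->
  eta eH (tilt k t) <= eta eH lam * expR (2 * (a k * t + K * t ^+ 2)).
Proof.
have eta0 := eta_gt0 eH_edge lam_gt0.
have pair AB : exists K, 0 <= K /\ (complete_to eH AB.1 AB.2 ->
    forall k t, `|t| <= 2^-1 ->
    setw (tilt k t) AB.1 * setw (tilt k t) AB.2 <=
      eta eH lam * expR (2 * (a k * t + K * t ^+ 2))).
  have [ABM|ABM] := boolP (AB \in Mset eH lam).
    by exists 2; split => // _ k t t2; exact: tilt_optimal.
  have [ABc|_] := boolP (complete_to eH AB.1 AB.2); last by exists 0; split.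
  by have [K K0 KP] := tilt_suboptimal ABc ABM; exists K; split.
have [K KP] := choice pair.
exists (1 + \sum_AB K AB).
  by rewrite lerDl; apply: sumr_ge0 => AB _; case: (KP AB).
move=> k t t2; apply/bigmax_leP; split=> [|AB ABc].
  by rewrite mulr_ge0 ?expR_ge0 ?ltW.
have [_ KAB] := KP AB; apply: (le_trans (KAB ABc k t t2)).
rewrite ler_pM2l// ler_expR ler_pM2l// lerD2l ler_wpM2r ?sqr_ge0//.
rewrite (bigD1 AB)//= addrCA lerDl addr_ge0// sumr_ge0// => AB' _.
by case: (KP AB').
Qed.

End Tilt.

(** * Exponential moments of the colour frequencies *)

Section Moments.
Variables (R : realType) (W : finType) (eH : rel W).
Hypothesis eH_sym : symmetric eH.
Hypothesis eH_edge : exists i j : W, eH i j.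
Variable lam : W -> R.
Hypothesis lam_gt0 : forall i, 0 < lam i.
Variable a : W -> R.
Hypothesis a01 : forall k, 0 <= a k <= 1.
Variable K : R.
Hypothesis K_ge1 : 1 <= K.
Hypothesis etaP : forall k (t : R), `|t| <= 2^-1 ->
  eta eH (tilt lam k t) <= eta eH lam * expR (2 * (a k * t + K * t ^+ 2)).

Variables (V : finType) (e : rel V) (d : nat) (X : {set V}).
Hypothesis e_sym : symmetric e.
Hypothesis e_reg : regular e d.
Hypothesis d_gt0 : (0 < d)%N.
Hypothesis e_bip : forall u v, e u v -> (u \in X) != (v \in X).
Hypothesis V_gt0 : (0 < #|V|)%N.

Let N : R := #|V|%:R.
Let N_gt0 : 0 < N. Proof. by rewrite ltr0n. Qed.

Definition expect (F : {ffun V -> W} -> R) : R :=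
  \sum_(f in Defs.Hom eH e) pcol eH lam e f * F f.

Lemma Zpart_gt0 : 0 < Zpart eH lam e.
Proof.
apply: lt_le_trans (Zpart_ge eH_sym lam_gt0 e_sym e_reg d_gt0 e_bip).
by rewrite exprn_gt0// (eta_gt0 eH_edge lam_gt0).
Qed.

Lemma pcol_ge0 f : 0 <= pcol eH lam e f.
Proof. by rewrite divr_ge0 ?ltW ?Zpart_gt0 ?(colw_gt0 lam_gt0). Qed.

Lemma expect_cst c : expect (fun=> c) = c.
Proof.
rewrite /expect -mulr_suml -mulr_suml -/(Zpart eH lam e).
by rewrite divff ?mul1r// gt_eqF// Zpart_gt0.
Qed.

Lemma le_expect F G : (forall f, F f <= G f) -> expect F <= expect G.
Proof. by move=> FG; apply: ler_sum => f _; rewrite ler_wpM2l ?pcol_ge0. Qed.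

Lemma expectD F G : expect (fun f => F f + G f) = expect F + expect G.
Proof. by rewrite -big_split; apply: eq_bigr => f _; rewrite mulrDr. Qed.

Lemma expectZ c F : expect (fun f => c * F f) = c * expect F.
Proof. by rewrite mulr_sumr; apply: eq_bigr => f _; rewrite mulrCA. Qed.

Lemma expect_sum (I : finType) (F : I -> {ffun V -> W} -> R) :
  expect (fun f => \sum_i F i f) = \sum_i expect (F i).
Proof.
rewrite /expect exchange_big/=; apply: eq_bigr => f _.
by rewrite mulr_sumr.
Qed.

Lemma prob_expect (E : pred {ffun V -> W}) :
  prob eH lam e E = expect (fun f => (E f)%:R).
Proof.
rewrite /prob /expect big_mkcondr/=; apply: eq_bigr => f _.
by case: ifP; rewrite ?mulr1 ?mulr0.
Qed.

(** The factor (2 ^ (#|W| / d)) ^ #|X| of the upper bound on the partition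
    function is exp (#|V| * palette_cost / d). *)
Definition palette_cost : R := #|W|%:R * ln 2 / 2.

Lemma palette_cost_gt0 : 0 < palette_cost.
Proof.
rewrite /palette_cost divr_gt0 ?mulr_gt0 ?ln_gt0 ?ltr1n// ltr0n.
by have [i _] := eH_edge; apply/card_gt0P; exists i.
Qed.

Lemma colour_count (f : {ffun V -> W}) k :
  \sum_v (f v == k)%:R = N * colour_freq R f k.
Proof.
rewrite /colour_freq mulrC divfK ?gt_eqF// -natr_sum -sum1_card; congr _%:R.
by rewrite [RHS]big_mkcond/=; apply: eq_bigr => v _; rewrite !inE; case: eqP.
Qed.

(** Tilting by exp(t) generates the exponential moments of the number of
    vertices of colour k. *)
Lemma Zpart_tilt k (t : R) :
  Zpart eH (tilt lam k t) e =
  Zpart eH lam e * expect (fun f => expR (t * (N * colour_freq R f k))).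
Proof.
rewrite mulr_sumr; apply: eq_bigr => f _.
rewrite mulrA mulrCA divff ?gt_eqF ?Zpart_gt0// mulr1 -colour_count mulr_sumr.
by rewrite expR_sum -big_split.
Qed.

(** The upper bound on the tilted partition function over the lower bound on the
    original one, with the effect of the tilt on eta. *)
Lemma moment_le k (t : R) : `|t| <= 2^-1 ->
  expect (fun f => expR (t * (N * (colour_freq R f k - a k)))) <=
    expR (N * (K * t ^+ 2 + palette_cost / d%:R)).
Proof.
move=> t2.
have -> : expect (fun f => expR (t * (N * (colour_freq R f k - a k)))) =
    expR (- (t * (N * a k))) * expect (fun f => expR (t * (N * colour_freq R f k))).
  rewrite -expectZ; apply: eq_bigr => f _; rewrite -expRD; congr (_ * expR _).
  by ring.
have eta0 := eta_gt0 eH_edge lam_gt0.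
rewrite expRN ler_pdivrMl ?expR_gt0// -(ler_pM2l Zpart_gt0) -Zpart_tilt.
apply: (le_trans (Zpart_le eH_sym eH_edge (tilt_gt0 lam_gt0 k t)
  e_sym e_reg d_gt0 e_bip)).
apply: le_trans (ler_wpM2r _ (Zpart_ge eH_sym lam_gt0 e_sym e_reg d_gt0 e_bip));
  last by rewrite mulr_ge0 ?expR_ge0.
rewrite -expRD.
have -> : t * (N * a k) + N * (K * t ^+ 2 + palette_cost / d%:R) =
  #|X|%:R * (2 * (a k * t + K * t ^+ 2) + #|W|%:R * ln 2 / d%:R).
  rewrite /N /palette_cost (card_V e_sym e_reg d_gt0 e_bip) natrD.
  by field; rewrite pnatr_eq0 -lt0n.
rewrite expRM_natl -exprMn.
have pow2 : (2 ^+ #|W|) `^ d%:R^-1 = expR (#|W|%:R * ln 2 / d%:R) :> R.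
  rewrite /powR gt_eqF ?exprn_gt0// lnXn// -[ln 2 *+ _]mulr_natl; congr expR.
  by rewrite mulrC.
rewrite pow2 expRD mulrA lerXn2r ?nnegrE ?mulr_ge0 ?expR_ge0//.
- by rewrite ltW// (eta_gt0 eH_edge (tilt_gt0 lam_gt0 k t)).
- exact: ltW.
- by rewrite ler_wpM2r ?expR_ge0// etaP.
Qed.

Lemma colour_freq_itv (f : {ffun V -> W}) k : 0 <= colour_freq R f k <= 1.
Proof.
rewrite divr_ge0//= ler_pdivrMr// mul1r ler_nat.
exact: max_card.
Qed.

Lemma sup_dist_le1 (f : {ffun V -> W}) : sup_dist (colour_freq R f) a <= 1.
Proof.
apply/bigmax_leP; split => // k _.
have := a01 k; have := colour_freq_itv f k; move=> /andP[? ?] /andP[? ?].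
by rewrite ler_norml; apply/andP; split; lra.
Qed.

(** Chernoff bound with the optimal tilt eps / 2K, for both signs and all colours
    at once. *)
Lemma deviation_le (eps : R) : 0 < eps -> eps <= 1 ->
  8 * K * palette_cost / d%:R <= eps ^+ 2 ->
  prob eH lam e (fun f => eps <= sup_dist (colour_freq R f) a) <=
    2 * #|W|%:R * expR (- (eps ^+ 2 * N / (8 * K))).
Proof.
move=> eps0 eps1 epsd; have K0 : 0 < K := lt_le_trans ltr01 K_ge1.
pose t := eps / (2 * K).
have t0 : 0 < t by rewrite divr_gt0// mulr_gt0.
have t2 : `|t| <= 2^-1.
  by rewrite gtr0_norm// /t ler_pdivrMr ?mulr_gt0// mulKf ?pnatr_eq0// (le_trans eps1).
pose dev (s : R) k (f : {ffun V -> W}) := expR (s * (N * (colour_freq R f k - a k))).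
have markov (f : {ffun V -> W}) :
    (eps <= sup_dist (colour_freq R f) a)%R%:R <=
    expR (- (t * (N * eps))) * \sum_k (dev t k f + dev (- t) k f).
  case: (lerP eps) => [dist|_]; last first.
    by rewrite mulr_ge0 ?expR_ge0// sumr_ge0// => k _; rewrite addr_ge0 ?expR_ge0.
  have [k kdev] : exists k, eps <= `|colour_freq R f k - a k|.
    apply/existsP; apply: contraLR dist; rewrite negb_exists -ltNge => /forallP H.
    by apply/bigmax_ltP; split => // k _; rewrite ltNge.
  rewrite expRN ler_pdivlMl ?expR_gt0// mulr1.
  rewrite (bigD1 k)//= ler_wpDr ?sumr_ge0// => [i _|].
    by rewrite addr_ge0 ?expR_ge0.
  have large (s u : R) : s * u = t * `|u| -> eps <= `|u| ->
      expR (t * (N * eps)) <= expR (s * (N * u)).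
    by move=> su eu; rewrite ler_expR mulrCA [leRHS]mulrCA su ler_pM2l// ler_pM2l.
  have [u0|/ltW u0] := leP 0 (colour_freq R f k - a k).
    by rewrite ler_wpDr ?expR_ge0// large// ger0_norm.
  by rewrite ler_wpDl ?expR_ge0// large// ler0_norm// mulrN mulNr.
rewrite prob_expect; apply: (le_trans (le_expect markov)).
rewrite expectZ expect_sum.
have mom k : expect (fun f => dev t k f + dev (- t) k f) <=
    2 * expR (N * (K * t ^+ 2 + palette_cost / d%:R)).
  rewrite expectD mulr2n mulrDl mul1r lerD ?moment_le//.
  by rewrite -(sqrrN t) moment_le// normrN.
apply: (le_trans (ler_wpM2l (expR_ge0 _) (ler_sum _ (fun k _ => mom k)))).
rewrite sumr_const -[_ *+ _]mulr_natl.
set A := expR _; set M := expR _.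
have -> : A * (#|W|%:R * (2 * M)) = 2 * #|W|%:R * (A * M) by ring.
rewrite /A /M -expRD ler_wpM2l ?mulr_ge0// ler_expR.
have small : palette_cost / d%:R <= eps ^+ 2 / (8 * K).
  by rewrite ler_pdivlMr ?mulr_gt0// mulrC mulrA.
rewrite -subr_ge0 (_ : _ - _ =
    N * (eps ^+ 2 / (8 * K) - palette_cost / d%:R)).
  by rewrite mulr_ge0 ?(ltW N_gt0)// subr_ge0.
by rewrite /t; field; rewrite ?pnatr_eq0 -?lt0n ?d_gt0 ?gt_eqF.
Qed.

Lemma pbar_expect k : pbar eH lam e k = expect (fun f => colour_freq R f k).
Proof.
rewrite /pbar; under eq_bigr do rewrite prob_expect.
rewrite -expect_sum mulrC -expectZ; apply: eq_bigr => f _; congr (_ * _).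
by rewrite colour_count mulKf// gt_eqF.
Qed.

(** Jensen's inequality for the exponential, from its tangent at the mean. *)
Lemma expR_expect_le F : expR (expect F) <= expect (fun f => expR (F f)).
Proof.
have -> : expR (expect F) =
    expect (fun f => expR (expect F) * (1 - expect F + F f)).
  by rewrite expectZ expectD expect_cst subrK mulr1.
apply: le_expect => f; rewrite -[in leRHS](subrK (expect F) (F f)) expRD mulrC.
rewrite ler_wpM2r ?expR_ge0//; apply: le_trans (expR_ge1Dx _).
by rewrite -addrA [- _ + _]addrC.
Qed.

Lemma pbar_dist k :
  `|pbar eH lam e k - a k| <= (K + 2 * palette_cost) / Num.sqrt d%:R.
Proof.
have sq0 : 0 < Num.sqrt d%:R :> R by rewrite sqrtr_gt0 ltr0n.
have sqE : Num.sqrt d%:R ^+ 2 = d%:R :> R by rewrite sqr_sqrtr// ler0n.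
have sq1 : 1 <= Num.sqrt d%:R :> R by rewrite -[leLHS]sqrtr1 ler_wsqrtr// ler1n.
set s := Num.sqrt _ in sq0 sqE sq1 *.
have side (t : R) : `|t| <= 2^-1 -> t * (pbar eH lam e k - a k) <=
    K * t ^+ 2 + palette_cost / d%:R.
  move=> t2; rewrite -(ler_pM2l N_gt0) -ler_expR; apply: le_trans (moment_le k t2).
  have -> : N * (t * (pbar eH lam e k - a k)) =
      expect (fun f => t * (N * (colour_freq R f k - a k))).
    by rewrite expectZ expectZ expectD expect_cst pbar_expect mulrCA.
  exact: expR_expect_le.
(* Up to constants this t balances K t^2 against palette_cost / d. *)
pose t : R := (2 * s)^-1.
have t0 : 0 < t by rewrite invr_gt0 mulr_gt0.
have t2 : `|t| <= 2^-1.
  by rewrite gtr0_norm// lef_pV2 ?posrE ?mulr_gt0// ler_peMr.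
have bound (x : R) : t * x <= K * t ^+ 2 + palette_cost / d%:R ->
    x <= (K + 2 * palette_cost) / s.
  rewrite -ler_pdivlMl// => /le_trans; apply.
  rewrite -sqE /t -subr_ge0 (_ : _ - _ = K / (2 * s)).
    by rewrite divr_ge0 ?mulr_ge0 ?(ltW sq0)// (le_trans ler01 K_ge1).
  by field; rewrite gt_eqF.
rewrite ler_norml lerNl; apply/andP; split; last exact/bound/side.
by apply: bound; rewrite mulrN -mulNr -(sqrrN t); apply: side; rewrite normrN.
Qed.

End Moments.

(** * Concentration of the colour frequencies *)

Theorem corollary1p3 (R : realType) (W : finType) (eH : rel W) (lam : W -> R)
  (eH_sym : symmetric eH) (eH_edge : exists i j : W, eH i j)
  (lam_gt0 : forall i : W, 0 < lam i)
  (a : W -> R)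
  (ha : forall k : W, a_minus eH lam k = a k /\ a_plus eH lam k = a k) :
  exists c1 c2 c3 c4 : R,
    [/\ 0 < c1, 0 < c2, 0 < c3 & 0 < c4] /\
    forall (d N : nat) (V : finType) (e : rel V),
      (1 <= d)%N -> (1 <= N)%N -> #|V| = N ->
      simple_graph e -> regular e d -> bipartite e ->
      (forall eps : R, c1 / Num.sqrt d%:R <= eps ->
         prob eH lam e (fun f => eps <= sup_dist (colour_freq R f) a)
           <= c2 * eps^-1 * 2 `^ (- (c3 * eps ^+ 2 * N%:R)))
      /\ sup_dist (pbar eH lam e) a <= c4 * zeta R d N.
Proof.
have [K K1 etaP] := eta_tilt eH_edge lam_gt0 ha.
have K0 : 0 < K := lt_le_trans ltr01 K1.
have aI := a_itv eH_edge lam_gt0 ha.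
have W0 : 0 < #|W|%:R :> R.
  by rewrite ltr0n; have [i _] := eH_edge; apply/card_gt0P; exists i.
have ln2 : 0 < ln 2 :> R by rewrite ln_gt0// ltr1n.
pose c := palette_cost R W.
have c0 : 0 < c := palette_cost_gt0 R eH_edge.
exists (Num.sqrt (8 * K * c)), (2 * #|W|%:R), (8 * K * ln 2)^-1, (K + 2 * c).
have c20 : 0 < 2 * c by exact: mulr_gt0.
have Kc0 : 0 < 8 * K * c by apply: mulr_gt0 => //; exact: mulr_gt0.
have Kl0 : 0 < 8 * K * ln 2 :> R by rewrite !mulr_gt0.
split; first by split; rewrite ?sqrtr_gt0 ?invr_gt0//;
  [exact: mulr_gt0 | exact: addr_gt0].
move=> d N V e d1 N1 VN [e_sym _] e_reg [X e_bip].
have V0 : (0 < #|V|)%N by rewrite VN.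
have dR : 0 < d%:R :> R by rewrite ltr0n.
have sd0 : 0 < Num.sqrt d%:R :> R by rewrite sqrtr_gt0.
split=> [eps eps_ge|]; last first.
  have zeta_ge : 1 / Num.sqrt d%:R <= zeta R d N by rewrite le_max lexx.
  have c40 : 0 <= K + 2 * c by rewrite addr_ge0 ?(ltW K0) ?(ltW c20).
  have target : (K + 2 * c) / Num.sqrt d%:R <= (K + 2 * c) * zeta R d N.
    by rewrite ler_wpM2l// -[leLHS]mul1r.
  apply/bigmax_leP; split=> [|k _]; apply: le_trans target.
    by rewrite divr_ge0// ltW.
  exact: (pbar_dist eH_sym eH_edge lam_gt0 K1 etaP e_sym e_reg d1 e_bip V0).
have eps0 : 0 < eps.
  by apply: lt_le_trans eps_ge; rewrite divr_gt0// sqrtr_gt0.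
have [eps1|eps1] := lerP eps 1; last first.
  rewrite /prob big_pred0 => [|f]; last first.
    apply/negbTE; rewrite negb_and -ltNge; apply/orP; right.
    exact: le_lt_trans (sup_dist_le1 aI V0 f) eps1.
  by rewrite !mulr_ge0 ?powR_ge0 ?invr_ge0 ?(ltW eps0).
have epsd : 8 * K * c / d%:R <= eps ^+ 2.
  have -> : 8 * K * c / d%:R = (Num.sqrt (8 * K * c) / Num.sqrt d%:R) ^+ 2.
    by rewrite expr_div_n !sqr_sqrtr ?(ltW dR) ?(ltW Kc0).
  by rewrite lerXn2r ?nnegrE ?divr_ge0 ?sqrtr_ge0// ltW.
have := deviation_le eH_sym eH_edge lam_gt0 K1 etaP e_sym e_reg d1 e_bip V0
  eps0 eps1 epsd.
move=> /le_trans; apply; rewrite VN -[leRHS]mulrA ler_pM2l ?mulr_gt0//.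
have -> : 2 `^ (- ((8 * K * ln 2)^-1 * eps ^+ 2 * N%:R)) =
    expR (- (eps ^+ 2 * N%:R / (8 * K))).
  rewrite /powR pnatr_eq0/=; congr expR.
  by field; rewrite !gt_eqF.
by rewrite ler_peMl ?expR_ge0// invf_ge1.
Qed.
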